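(* Let $T_{\mathfrak{so}_5} \in \mathfrak{so}_5^* \otimes \mathfrak{so}_5^* \otimes \mathfrak{so}_5$ be the structure tensor of the complex Lie algebra $\mathfrak{so}_5$. Then its border rank satisfies $\underline{\mathbf{R}}(T_{\mathfrak{so}_5}) \geq 19$.
   Context: $\mathfrak{so}_n$ denotes the complex Lie algebra of skew-symmetric $n\times n$ complex matrices with bracket $[x,y]=xy-yx$ (note $\mathfrak{so}_5\simeq\mathfrak{sp}_4$). For a Lie algebra $\mathfrak{g}$, its structure tensor $T_{\mathfrak{g}}\in\mathfrak{g}^*\otimes\mathfrak{g}^*\otimes\mathfrak{g}$ is the tensor corresponding to the bilinear map $(x,y)\mapsto[x,y]$; in a basis $\{a_i\}$ with dual basis $\{\alpha^i\}$ and $[a_i,a_j]=\sum_k A_{ij}^k a_k$, it is $\sum_{i,j,k}A_{ij}^k\,\alpha^i\otimes\alpha^j\otimes a_k$. For a tensor $T\in A\otimes B\otimes C$ over $\mathbb{C}$, the rank of $T$ is the minimal $r$ with $T=\sum_{i=1}^r a_i\otimes b_i\otimes c_i$, and the border rank $\underline{\mathbf{R}}(T)$ is the minimal $r$ such that $T=\lim_{\epsilon\to 0}T_\epsilon$ with each $T_\epsilon$ of rank at most $r$. *)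

(* Defs.v *)
(* with MathComp-Analysis for limits.
   The complex numbers are modelled as R[i] = complex R for R : realType
   (every realType is a complete archimedean ordered field, i.e. the reals). *)
From HB Require Import structures.
From mathcomp Require Import all_boot all_order all_algebra.
From mathcomp Require Import complex.
From mathcomp Require Import all_classical all_reals all_analysis.
Set Implicit Arguments. Unset Strict Implicit. Unset Printing Implicit Defensive.
Import Order.TTheory GRing.Theory Num.Theory.
Import numFieldNormedType.Exports.
(* R^o (regular algebra alias) carries the norm topology of a numDomainType;
   this is how we equip C = R[i] with its usual (Euclidean) topology. *)
Local Open Scope ring_scope.
Local Open Scope complex_scope.
Local Open Scope classical_set_scope.

(* A tensor in A (x) B (x) C, given by its coordinates in fixed bases
   indexed by the finite types I, J, K. *)
Definition tensor (F : Type) (I J K : finType) := I -> J -> K -> F.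

Definition rank_le (F : comNzRingType) (I J K : finType) (T : tensor F I J K)
    (r : nat) : Prop :=
  exists (a : 'I_r -> I -> F) (b : 'I_r -> J -> F) (c : 'I_r -> K -> F),
    forall i j k, T i j k = \sum_(l < r) a l i * b l j * c l k.

Definition border_rank_le (R : realType) (I J K : finType)
    (T : tensor R[i] I J K) (r : nat) : Prop :=
  exists Te : R[i] -> tensor R[i] I J K,
    (forall e : R[i], e != 0 -> rank_le (Te e) r) /\
    (forall i j k,
       (fun e : (R[i])^o => (Te e i j k : (R[i])^o)) @ (0 : (R[i])^o)^'
         --> (T i j k : (R[i])^o)).

(* so_5: skew-symmetric 5x5 complex matrices, bracket [x,y] = xy - yx.
   Basis: a_(p,q) = E_pq - E_qp for p < q (indexed by the finite type so5_idx). *)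
Definition so5_idx := {pq : 'I_5 * 'I_5 | pq.1 < pq.2}%N.

Definition so5_basis (R : realType) (s : so5_idx) : 'M[R[i]]_5 :=
  delta_mx (val s).1 (val s).2 - delta_mx (val s).2 (val s).1.

Definition lie_bracket (F : comNzRingType) (n : nat) (x y : 'M[F]_n) : 'M[F]_n :=
  x *m y - y *m x.

(* coordinate of a skew-symmetric matrix M along a_(p,q): M = sum_{p<q} M_pq a_(p,q) *)
Definition so5_coord (R : realType) (M : 'M[R[i]]_5) (s : so5_idx) : R[i] :=
  M (val s).1 (val s).2.

(* Structure tensor T = sum A_{st}^u alpha^s (x) alpha^t (x) a_u,
   where [a_s, a_t] = sum_u A_{st}^u a_u. *)
Definition T_so5 (R : realType) : tensor R[i] so5_idx so5_idx so5_idx :=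
  fun s t u => so5_coord (lie_bracket (so5_basis R s) (so5_basis R t)) u.

(* Main.v *)
(* Border substitution: if the border rank of [T] is at most [r.+1], then [T] modulo some line of
   the first factor has border rank at most [r]. The set of such lines is closed and stable under
   the symmetries of [T], so it contains a line fixed by a Borel subgroup. The structure tensor of
   [so_5] is invariant under [SO_5]; applying this twice (the second time with the Borel subgroup
   fixing the first line) reduces border rank 18 to border rank 16 for the quotient by the unique
   Borel-fixed plane. On a seven-dimensional quotient of the remaining eight-dimensional factor
   the Koszul flattening [Lambda^3 (x) B^* -> Lambda^4 (x) C] has rank at least 322, whereas a
   tensor of rank one contributes at most ['C(6, 3) = 20], and [16 * 20 = 320]. *)
Require Import Defs.
From HB Require Import structures.
From mathcomp Require Import all_boot all_order all_algebra.
From mathcomp Require Import complex.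
From mathcomp Require Import all_classical all_reals all_analysis.
From mathcomp Require Import ring.
Set Implicit Arguments. Unset Strict Implicit. Unset Printing Implicit Defensive.
Import Order.TTheory GRing.Theory Num.Theory.
Import numFieldNormedType.Exports.
Local Open Scope ring_scope.

(** * Tensor rank and approximation *)

(** A Koszul flattening alone cannot reach 19: on an n-dimensional quotient of the first factor it
    proves at most 10 * n / max(n - k, k + 1), rounded up, and this stays at most 18 for every n up
    to 10. Hence the two substitutions, each of which gains one. The fixed line is reached by hand.
    For a simple root vector e one has (ad e)^3 = 0, so exp(s ad e) is quadratic in s, and rescaled
    translates converge, as s grows, to the leading coefficient. Repeating this pushes any direction
    up the weight filtration until both simple root vectors kill it, and their common kernel is a
    single line. Border rank is used in the form of approximation within every d > 0, which passes
    to limits of directions. The rank of the flattening is certified by a minor that is triangular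
    modulo 3, so that only divisibilities have to be computed. *)

Definition app_vec (F : pzRingType) (I I' : finType) (g : I -> I' -> F)
  (x : I' -> F) (i : I) : F := \sum_i' g i i' * x i'.

Definition mapA (F : comNzRingType) (I I' J K : finType) (g : I -> I' -> F)
  (T : tensor F I' J K) : tensor F I J K :=
  fun i j k => app_vec g (fun i' => T i' j k) i.
Definition mapB (F : comNzRingType) (I J J' K : finType) (g : J -> J' -> F)
  (T : tensor F I J' K) : tensor F I J K :=
  fun i j k => app_vec g (fun j' => T i j' k) j.
Definition mapC (F : comNzRingType) (I J K K' : finType) (g : K -> K' -> F)
  (T : tensor F I J K') : tensor F I J K :=
  fun i j k => app_vec g (fun k' => T i j k') k.

Section RankLe.
Variables (F : comNzRingType) (I J K : finType).
Implicit Types T : tensor F I J K.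

Lemma rank_leS T r : rank_le T r -> rank_le T r.+1.
Proof.
move=> [a [b [c E]]].
pose ext (X : Type) (f : 'I_r -> X -> F) (l : 'I_r.+1) x :=
  if unlift ord_max l is Some l' then f l' x else 0.
exists (ext I a), (ext J b), (ext K c) => i j k; rewrite E big_ord_recr /=.
rewrite {4 5 6}/ext unlift_none !mulr0 addr0; apply: eq_bigr => l _.
suff U : unlift ord_max (widen_ord (leqnSn r) l) = Some l by rewrite /ext U.
by rewrite -[RHS](liftK ord_max); congr unlift; apply/val_inj => /=; rewrite /bump leqNgt ltn_ord.
Qed.

Lemma rank_le_mono T r s : (r <= s)%N -> rank_le T r -> rank_le T s.
Proof.
by move=> /subnK <-; elim: (s - r)%N => [//|m IH] /IH; rewrite addSn; apply: rank_leS.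
Qed.

Lemma rank_le_mapA (I' : finType) (g : I' -> I -> F) T r :
  rank_le T r -> rank_le (mapA g T) r.
Proof.
move=> [a [b [c E]]]; exists (fun l => app_vec g (a l)), b, c => i j k.
under eq_bigr => l _ do rewrite /app_vec -mulrA mulr_suml.
rewrite exchange_big /mapA /app_vec; apply: eq_bigr => i' _.
by rewrite E mulr_sumr; apply: eq_bigr => l _; rewrite !mulrA.
Qed.

Lemma rank_le_mapB (J' : finType) (g : J' -> J -> F) T r :
  rank_le T r -> rank_le (mapB g T) r.
Proof.
move=> [a [b [c E]]]; exists a, (fun l => app_vec g (b l)), c => i j k.
under eq_bigr => l _ do rewrite /app_vec mulr_sumr mulr_suml.
rewrite exchange_big /mapB /app_vec; apply: eq_bigr => i' _.
by rewrite E mulr_sumr; apply: eq_bigr => l _; rewrite !mulrA (mulrC (a l i)).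
Qed.

Lemma rank_le_mapC (K' : finType) (g : K' -> K -> F) T r :
  rank_le T r -> rank_le (mapC g T) r.
Proof.
move=> [a [b [c E]]]; exists a, b, (fun l => app_vec g (c l)) => i j k.
under eq_bigr => l _ do rewrite /app_vec mulr_sumr.
rewrite exchange_big /mapC /app_vec; apply: eq_bigr => i' _.
by rewrite E mulr_sumr; apply: eq_bigr => l _; rewrite mulrCA.
Qed.

End RankLe.

Section Approximation.
Variable F : numFieldType.

(** Closeness is asked only on the support of row [i] of [g]: a map that respects [D] can then be
    applied when nothing is known outside [D]. The bound [d / (1 + C)] avoids a division by zero
    when [g] vanishes. *)
Lemma app_vec_close (I I' : finType) (g : I -> I' -> F) (d : F) : 0 < d ->
  exists2 d', 0 < d' & forall (x y : I' -> F) i,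
    (forall i', g i i' != 0 -> `|x i' - y i'| < d') ->
    `|app_vec g x i - app_vec g y i| < d.
Proof.
move=> d0; pose C : F := \sum_i \sum_i' `|g i i'|.
have C0 : 0 <= C by apply: sumr_ge0 => i _; apply: sumr_ge0 => i' _.
have C1 : 0 < 1 + C by rewrite ltr_pwDl.
have d'0 : 0 < d / (1 + C) by rewrite divr_gt0.
exists (d / (1 + C)) => // x y i H.
rewrite /app_vec -sumrB; under eq_bigr => i' _ do rewrite -mulrBr.
apply: (le_lt_trans (ler_norm_sum _ _ _)).
apply: (@le_lt_trans _ _ (C * (d / (1 + C)))); last first.
  by rewrite mulrCA gtr_pMr // ltr_pdivrMr // mul1r ltrDr.
apply: (@le_trans _ _ (\sum_i' `|g i i'| * (d / (1 + C)))).
  apply: ler_sum => i' _; rewrite normrM.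
  have [->|g0] := eqVneq (g i i') 0; first by rewrite normr0 !mul0r.
  by apply: ler_wpM2l => //; apply/ltW/H.
rewrite -mulr_suml; apply: ler_wpM2r; first exact: ltW.
rewrite /C (bigD1 i) //= lerDl.
by apply: sumr_ge0 => i'' _; apply: sumr_ge0 => i' _.
Qed.

Section Slices.
Variables (I J K : finType) (D : pred I).
Implicit Types (T : tensor F I J K) (a : I -> F).

(** Keeping only the slices in [D] is the quotient of the first factor by the other coordinate
    vectors; with a predicate the index type, and so the operators on it, stay the same through both
    substitutions. *)
Definition approx_rank r T : Prop := forall d : F, 0 < d ->
  exists2 S : tensor F I J K, rank_le S r &
    forall i j k, D i -> `|S i j k - T i j k| < d.

(* [T] modulo [a] is a limit of tensors of rank at most [r]; the vector [a] may move along with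
   the tensor, so that this is a closed condition on [a]. *)
Definition approx_rank_mod r T a : Prop := forall d : F, 0 < d ->
  exists a' M (S : tensor F I J K),
    [/\ rank_le S r, forall i, D i -> `|a' i - a i| < d &
        forall i j k, D i -> `|a' i * M j k + S i j k - T i j k| < d].

Lemma approx_rank_mono r s T :
  (r <= s)%N -> approx_rank r T -> approx_rank s T.
Proof.
by move=> rs H d /H [S Sr HS]; exists S => //; apply: rank_le_mono Sr.
Qed.

Lemma approx_rank_mod_ext r T T' a a' :
  (forall i j k, D i -> T i j k = T' i j k) -> (forall i, D i -> a i = a' i) ->
  approx_rank_mod r T a -> approx_rank_mod r T' a'.
Proof.
move=> ET Ea H d /H [b [M [S [rS Hb HS]]]]; exists b, M, S.
by split=> // [i Di|i j k Di]; [rewrite -Ea ?Hb | rewrite -ET ?HS].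
Qed.

Lemma approx_rank_mod_scale r T a c :
  c != 0 -> approx_rank_mod r T a -> approx_rank_mod r T (fun i => c * a i).
Proof.
move=> c0 H d d0; have nc0 : 0 < `|c| by rewrite normr_gt0.
have [|a' [M [S [rS Ha HS]]]] := H (d / (1 + `|c|)).
  by rewrite divr_gt0 // ltr_pwDl.
exists (fun i => c * a' i), (fun j k => c^-1 * M j k), S.
have c1 : 0 < 1 + `|c| by rewrite ltr_pwDl.
split=> // [i Di|i j k Di]; [have H1 := Ha i Di | have H1 := HS i j k Di].
  rewrite -mulrBr normrM; apply: (@le_lt_trans _ _ (`|c| * (d / (1 + `|c|)))).
    by rewrite ler_pM2l // ltW.
  by rewrite mulrCA gtr_pMr // ltr_pdivrMr // mul1r ltrDr.
rewrite mulrACA divff // mul1r; apply: lt_le_trans H1 _.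
by rewrite ler_pdivrMr // ler_peMr ?(ltW d0) // lerDl.
Qed.

Lemma approx_rank_mod_closed r T a :
  (forall d, 0 < d -> exists2 b, approx_rank_mod r T b &
     forall i, D i -> `|b i - a i| < d) ->
  approx_rank_mod r T a.
Proof.
move=> H d d0; have d2 : 0 < d / 2 by rewrite divr_gt0.
have [b Hb ba] := H _ d2; have [a' [M [S [rS Ha HS]]]] := Hb _ d2.
exists a', M, S; split=> // [i Di|i j k Di].
  rewrite (splitr d) -(subrK (b i) (a' i)) -addrA.
  by apply: le_lt_trans (ler_normD _ _) _; rewrite ltrD ?Ha ?ba.
apply: (lt_le_trans (HS i j k Di)).
by rewrite ler_pdivrMr // ler_peMr ?ltW // ltr1n.
Qed.

(** The condition on [g] says that it descends to the quotient: outside [D] neither [a'] nor [S] is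
    controlled. *)
Lemma approx_rank_mod_mapA r T a (g : I -> I -> F) :
  (forall i i', D i -> ~~ D i' -> g i i' = 0) ->
  approx_rank_mod r T a -> approx_rank_mod r (mapA g T) (app_vec g a).
Proof.
move=> gD H d d0; have [d' d'0 Hd'] := app_vec_close g d0.
have gD' i i' : D i -> g i i' != 0 -> D i'.
  by move=> Di; apply: contraR => Di'; rewrite gD.
have [a' [M [S [rS Ha HS]]]] := H _ d'0.
exists (app_vec g a'), M, (mapA g S); split; first exact: rank_le_mapA.
  by move=> i Di; apply: Hd' => i' /(gD' _ _ Di); apply: Ha.
move=> i j k Di; have -> : app_vec g a' i * M j k + mapA g S i j k
    = app_vec g (fun i' => a' i' * M j k + S i' j k) i.
  rewrite /mapA /app_vec mulr_suml -big_split /=.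
  by apply: eq_bigr => i' _; rewrite mulrDr mulrA.
by apply: Hd' => i' /(gD' _ _ Di); apply: HS.
Qed.

Lemma approx_rank_mod_mapB r T a (g : J -> J -> F) :
  approx_rank_mod r T a -> approx_rank_mod r (mapB g T) a.
Proof.
move=> H d d0; have [d1 d10 Hd1] := app_vec_close g d0.
(* This quantity is below both [d] and [d1]; it stands in for their minimum, the order of [F] being
   only partial. *)
have m0 : 0 < d * d1 / (d + d1) by rewrite divr_gt0 ?mulr_gt0 ?addr_gt0.
have md : d * d1 / (d + d1) <= d.
  by rewrite ler_pdivrMr ?addr_gt0 // ler_pM2l // lerDr ltW.
have md1 : d * d1 / (d + d1) <= d1.
  by rewrite ler_pdivrMr ?addr_gt0 // mulrC ler_pM2l // lerDl ltW.
have [a' [M [S [rS Ha HS]]]] := H _ m0.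
exists a', (fun j k => app_vec g (M^~ k) j), (mapB g S).
split; first exact: rank_le_mapB.
  by move=> i /Ha/lt_le_trans; apply.
move=> i j k Di; have -> : a' i * app_vec g (M^~ k) j + mapB g S i j k
    = app_vec g (fun j' => a' i * M j' k + S i j' k) j.
  rewrite /mapB /app_vec mulr_sumr -big_split /=.
  by apply: eq_bigr => i' _; rewrite mulrDr mulrCA.
by apply: Hd1 => j' _; apply: lt_le_trans md1; apply: HS.
Qed.

Lemma approx_rank_mod_mapC r T a (g : K -> K -> F) :
  approx_rank_mod r T a -> approx_rank_mod r (mapC g T) a.
Proof.
move=> H d d0; have [d1 d10 Hd1] := app_vec_close g d0.
have m0 : 0 < d * d1 / (d + d1) by rewrite divr_gt0 ?mulr_gt0 ?addr_gt0.
have md : d * d1 / (d + d1) <= d.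
  by rewrite ler_pdivrMr ?addr_gt0 // ler_pM2l // lerDr ltW.
have md1 : d * d1 / (d + d1) <= d1.
  by rewrite ler_pdivrMr ?addr_gt0 // mulrC ler_pM2l // lerDl ltW.
have [a' [M [S [rS Ha HS]]]] := H _ m0.
exists a', (fun j k => app_vec g (M j) k), (mapC g S).
split; first exact: rank_le_mapC.
  by move=> i /Ha/lt_le_trans; apply.
move=> i j k Di; have -> : a' i * app_vec g (M j) k + mapC g S i j k
    = app_vec g (fun k' => a' i * M j k' + S i j k') k.
  rewrite /mapC /app_vec mulr_sumr -big_split /=.
  by apply: eq_bigr => i' _; rewrite mulrDr mulrCA.
by apply: Hd1 => k' _; apply: lt_le_trans md1; apply: HS.
Qed.

End Slices.
End Approximation.

(** * Compactness of bounded complex families, and limits as approximations *)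

Section Compactness.
Local Open Scope classical_set_scope.
Local Open Scope complex_scope.
Variable R : realType.
Local Notation Re := complex.Re.
Local Notation Im := complex.Im.

Lemma bounded_ultra_lim (U : set_system nat) (u : nat -> R) :
  UltraFilter U -> (forall n, `|u n| <= 1) ->
  exists l, forall e : R, 0 < e -> U [set n | `|u n - l| < e].
Proof.
move=> UU u1; have PU : ProperFilter U by exact: ultra_proper.
have cpt := @segment_compact R (-1) 1.
have [|l [_ lU]] := cpt (u @ U) (fmap_proper_filter u PU).
  by apply: (@filterE _ U) => n; rewrite /= in_itv /= -ler_norml; exact: u1.
exists l => e e0.
(* An ultrafilter that misses this set contains its complement, which would keep [u] away from its
   cluster point [l]. *)
have [//|NU] := in_ultra_setVsetC [set n | `|u n - l| < e] UU.
have Ul : (u @ U) (~` ball l e).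
  by apply: (@filterS _ U _ _ _ _ NU) => n; rewrite /= /ball /= distrC.
have [x [/= ? ?]] := lU _ _ Ul (nbhsx_ballx l e e0); contradiction.
Qed.

Lemma normc_le_ReIm (z : R[i]) : `|z| <= (`|Re z| + `|Im z|)%:C.
Proof.
rewrite {1}(complexE z) rmorphD /=; apply: (le_trans (ler_normD _ _)).
rewrite normrM !normc_def /= !expr0n /= !addr0 !add0r expr1n sqrtr1 mul1r.
by rewrite !sqrtr_sqr.
Qed.

(** One ultrafilter finer than the filter at infinity gives limits of all real and imaginary parts
    at once, instead of a subsequence extracted coordinate by coordinate. *)
Lemma bounded_family_cluster (I : finType) (u : nat -> I -> R[i]) :
  (forall n i, `|u n i| <= 1) ->
  exists a, forall d : R[i], 0 < d -> forall N,
    exists2 n, (N <= n)%N & forall i, `|u n i - a i| < d.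
Proof.
move=> u1; have [U [UU sU]] := @ultraFilterLemma nat \oo _.
have PU : ProperFilter U by exact: ultra_proper.
have re n i : `|Re (u n i)| <= 1.
  by rewrite -lecR (le_trans (normc_ge_Re _)).
have im n i : `|Im (u n i)| <= 1.
  rewrite -normrN -ReiNIm -lecR (le_trans (normc_ge_Re _)) //.
  by rewrite normrM (normc_def 'i) /= expr0n expr1n /= add0r sqrtr1 mulr1.
have /choice [b Hb] i := bounded_ultra_lim UU (re^~ i).
have /choice [c Hc] i := bounded_ultra_lim UU (im^~ i).
exists (fun i => b i +i* c i) => d d0 N.
have dE : d = (Re d)%:C by rewrite RRe_real // gtr0_real.
have d2 : 0 < Re d / 2 by rewrite divr_gt0 // -(@ltcR R) -dE.
have UN : U [set n | (N <= n)%N] by apply: sU; exact: nbhs_infty_ge.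
have FU : Filter U by exact: filter_filter.
have Ub := filter_forall FU (fun i => Hb i _ d2).
have Uc := filter_forall FU (fun i => Hc i _ d2).
have [n [[/= Nn nb] nc]] := filter_ex (filterI (filterI UN Ub) Uc).
exists n => // i; apply: (le_lt_trans (normc_le_ReIm _)).
rewrite dE ltcR (splitr (Re d)) ltrD //.
  by have := nb i; case: (u n i).
by have := nc i; case: (u n i).
Qed.

Lemma border_rank_le_approx (I J K : finType) (T : tensor R[i] I J K) r :
  border_rank_le T r -> forall d : R[i], 0 < d ->
  exists2 S : tensor R[i] I J K, rank_le S r &
    forall i j k, `|S i j k - T i j k| < d.
Proof.
move=> [Te [rTe cvTe]] d d0.
have nT : \forall e \near (0 : (R[i])^o)^', forall i j k, `|Te e i j k - T i j k| < d.
  apply: filter_forall => i; apply: filter_forall => j; apply: filter_forall => k.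
  have H := cvTe i j k (ball (T i j k : (R[i])^o) d) (nbhsx_ballx _ _ d0).
  by apply: (@filterS _ (0 : (R[i])^o)^' _ _ _ _ H) => e; rewrite /= /ball /= distrC.
have n0 : \forall e \near (0 : (R[i])^o)^', e != 0 by exact: nbhs_dnbhs_neq.
have [e [He e0]] := filter_ex (filterI nT n0).
by exists (Te e) => //; exact: rTe.
Qed.

End Compactness.

(** * Border substitution *)

Section DropCoordinate.
Variables (F : numFieldType) (I J K : finType) (D : pred I).
Implicit Types (T : tensor F I J K) (a : I -> F).

(** Projecting along [a'] onto the coordinates other than [i0] removes the term [a' * M]. As [a'] is
    close to the basis vector at [i0], the projection barely changes the remaining slices of [T]. *)
Lemma approx_rank_drop r T i0 c : c != 0 -> D i0 ->
  approx_rank_mod D r T (fun i => c * (i == i0)%:R) ->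
  approx_rank [pred i | D i && (i != i0)] r T.
Proof.
move=> c0 Di0 H1 d d0.
have {}H1 : approx_rank_mod D r T (fun i => (i == i0)%:R).
  apply: (approx_rank_mod_ext _ _
    (approx_rank_mod_scale (invr_neq0 c0) H1)) => // i _.
  by rewrite mulrA mulVf // mul1r.
(* [C] is chosen so that [m * C] splits as [m + m * 2 * (1 + sum) + m]: the direct error, then a
   bound for [a' i / a' i0] (at most [2 * m]) times the slice at [i0], with slack [m]. *)
pose C : F := 2 * (\sum_j \sum_k `|T i0 j k|) + 4.
have C0 : 0 < C.
  rewrite ltr_wpDl //; apply: mulr_ge0 => //.
  by apply: sumr_ge0 => j _; apply: sumr_ge0 => k _.
pose m := d / (2 * (d + C)).
have dC : 0 < 2 * (d + C) by rewrite mulr_gt0 // addr_gt0.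
have m0 : 0 < m by rewrite divr_gt0.
have m12 : m < 1 / 2.
  by rewrite ltr_pdivrMr // mulrA divfK // mul1r ltrDl.
have mC : m * C < d.
  rewrite mulrAC ltr_pdivrMr // ltr_pM2l //.
  rewrite mulr2n mulrDl mul1r -addrA ltr_pwDl //.
  by rewrite lerDl addr_ge0 // ltW.
have [a' [M [S [rS Ha HS]]]] := H1 _ m0.
have a0 : 1 / 2 < `|a' i0|.
  have := Ha _ Di0; rewrite eqxx => /lt_trans/(_ m12) h.
  have : 1 - `|a' i0| < 1 / 2.
    by apply: le_lt_trans h; rewrite -{1}(normr1 F) distrC lerB_dist.
  by rewrite ltrBlDr -ltrBlDl {1}(splitr 1) addrK.
have a'0 : a' i0 != 0 by rewrite -normr_gt0 (lt_trans _ a0) // divr_gt0.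
(* The projection that kills [a'], subtracting from x the multiple of [a'] with the same coordinate
   at [i0]. *)
pose g i i' : F := (i == i')%:R - (i' == i0)%:R * (a' i / a' i0).
have gE x i : app_vec g x i = x i - a' i / a' i0 * x i0.
  rewrite /app_vec /g; under eq_bigr => i' _ do rewrite mulrBl.
  rewrite sumrB (bigD1 i) //= eqxx mul1r big1 ?addr0; last first.
    by move=> i' /negPf; rewrite eq_sym => ->; rewrite mul0r.
  congr (_ - _); rewrite (bigD1 i0) //= eqxx mul1r big1 ?addr0 //.
  by move=> i' /negPf ->; rewrite !mul0r.
exists (mapA g S); first exact: rank_le_mapA.
move=> i j k /= /andP [Di ii0]; rewrite /mapA gE.
pose X i := a' i * M j k + S i j k.
have -> : S i j k - a' i / a' i0 * S i0 j k - T i j k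
    = (X i - T i j k) - a' i / a' i0 * X i0.
  by rewrite /X; field.
apply: (le_lt_trans (ler_normB _ _)).
have ai : `|a' i| < m by have := Ha _ Di; rewrite (negPf ii0) subr0.
have X0 : `|X i0| < 1 + \sum_j \sum_k `|T i0 j k|.
  rewrite -(subrK (T i0 j k) (X i0)); apply: (le_lt_trans (ler_normD _ _)).
  apply: ltr_leD.
    apply: (lt_trans (HS _ _ _ Di0)); apply: (lt_trans m12).
    by rewrite ltr_pdivrMr // mul1r ltr1n.
  rewrite (bigD1 j) //= (bigD1 k) //= -addrA lerDl addr_ge0 //.
    by apply: sumr_ge0 => ? _.
  by apply: sumr_ge0 => ? _; apply: sumr_ge0 => ? _.
apply: (lt_trans _ mC).
have -> : m * C = m + (m * 2 * (1 + \sum_j \sum_k `|T i0 j k|) + m).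
  by rewrite /C; ring.
apply: ltrD; first exact: HS.
rewrite ltr_wpDr ?(ltW m0) // normrM.
apply: ltr_pM => //; rewrite normrM normfV; apply: ltr_pM => //.
by rewrite invf_plt ?posrE // ?normr_gt0 // -div1r.
Qed.

End DropCoordinate.

Section BorderSubstitution.
Variables (R : realType) (I J K : finType) (D : pred I).
Implicit Types (T : tensor R[i] I J K) (a : I -> R[i]).

(** One rank-one term is split off, and its first vector is divided by its entry of largest modulus
    on [D]. Entries bounded by 1 give compactness, and the entry equal to 1 keeps the limit
    nonzero. *)
Lemma approx_rank_split r T i1 : D i1 -> approx_rank D r.+1 T ->
  forall d : R[i], 0 < d -> exists a M (S : tensor R[i] I J K),
    [/\ rank_le S r, forall i, `|a i| <= 1, exists2 i, D i & a i = 1 &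
        forall i j k, D i -> `|a i * M j k + S i j k - T i j k| < d].
Proof.
move=> Di1 H d /H [S [a [b [c ES]]] HS].
pose S' : tensor R[i] I J K := fun i j k =>
  \sum_(l < r) a (lift ord_max l) i * b (lift ord_max l) j * c (lift ord_max l) k.
have rS' : rank_le S' r by do 3!eexists; move=> i j k; reflexivity.
have SE i j k : S i j k = a ord_max i * (b ord_max j * c ord_max k) + S' i j k.
  rewrite ES big_ord_recr /= mulrA addrC; congr (_ + _).
  apply: eq_bigr => l _; rewrite (_ : widen_ord _ _ = lift ord_max l) //.
  by apply/val_inj; rewrite /= /bump leqNgt ltn_ord.
have [[i Di ai0]|a0] := pselect (exists2 i, D i & a ord_max i != 0).
  have [m Dm mmax] : exists2 m, D m & forall i, D i -> `|a ord_max i| <= `|a ord_max m|.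
    have [m Dm mmax] :=
      @Order.TotalTheory.arg_maxP _ R I i D (fun i => complex.Re `|a ord_max i|) Di.
    exists m => // i' Di'; rewrite -(RRe_real (normr_real (a ord_max i'))).
    by rewrite -(RRe_real (normr_real (a ord_max m))) lecR; exact: mmax.
  have am0 : a ord_max m != 0.
    by rewrite -normr_gt0 (lt_le_trans _ (mmax _ Di)) // normr_gt0.
  exists (fun i => if D i then a ord_max i / a ord_max m else 0).
  exists (fun j k => a ord_max m * (b ord_max j * c ord_max k)), S'; split=> //.
  - move=> i'; case: ifP => [Di'|_]; last by rewrite normr0 ler01.
    by rewrite normrM normfV ler_pdivrMr ?mul1r ?mmax // normr_gt0.
  - by exists m; rewrite ?Dm ?divff.
  - by move=> i' j k Di'; rewrite Di' [_ / _ * _]mulrA divfK // -SE HS.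
(* The term vanishes on [D], so any normalised vector will do, with [M = 0]. *)
exists (fun i => (i == i1)%:R), (fun _ _ => 0), S'; split=> //.
- by move=> i; case: eqP; rewrite ?normr1 ?normr0.
- by exists i1; rewrite ?eqxx.
- move=> i j k Di; rewrite mulr0 add0r.
  have [ai0|ai0] := eqVneq (a ord_max i) 0; last by case: a0; exists i.
  by have := HS i j k Di; rewrite SE ai0 mul0r add0r.
Qed.

Lemma approx_rank_substitution r T i1 : D i1 -> approx_rank D r.+1 T ->
  exists2 a, (exists2 i, D i & a i != 0) & approx_rank_mod D r T a.
Proof.
move=> Di1 H; have dn (n : nat) : 0 < (n.+1%:R : R[i])^-1 by rewrite invr_gt0.
have /choice [u Hu] n := approx_rank_split Di1 H (dn n).
have u1 n i : `|u n i| <= 1 by have [M [S []]] := Hu n.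
have [a Ha] := bounded_family_cluster u1.
exists a.
  apply: contrapT => a0.
  have h2 : 0 < 1 / 2 :> R[i] by rewrite divr_gt0.
  have h21 : 1 / 2 < 1 :> R[i] by rewrite ltr_pdivrMr // mul1r ltr1n.
  have [n _ Hn] := Ha _ h2 0%N.
  have [_ [_ [_ _ [i Di ui1] _]]] := Hu n.
  have := Hn i; rewrite ui1; have [->|ai0] := eqVneq (a i) 0.
    by rewrite subr0 normr1 => /lt_trans/(_ h21); rewrite ltxx.
  by case: a0; exists i.
move=> d d0.
have [N HN] : exists N : nat, (N.+1%:R : R[i])^-1 < d.
  have d1 : 0 < complex.Re d by rewrite -(@ltcR R) RRe_real // gtr0_real.
  exists (Num.truncn (complex.Re d)^-1).
  rewrite invf_plt ?posrE // -(RRe_real (gtr0_real d0)) -fmorphV /=.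
  rewrite -(rmorph_nat (real_complex R)) ltcR.
  by have := truncn_itv (ltW (_ : 0 < (complex.Re d)^-1)); rewrite invr_gt0 => /(_ d1)/andP [].
have [n Nn Hn] := Ha d d0 N.
have [M [S [rS _ _ HS]]] := Hu n.
exists (u n), M, S; split=> // i j k Di; apply: lt_trans (HS i j k Di) _.
by apply: le_lt_trans HN; rewrite lef_pV2 ?posrE // ler_nat.
Qed.

(** Divided by [s ^+ 2], the family tends to [z] as s grows; the condition is invariant under
    scaling and closed. *)
Lemma approx_rank_mod_lead r T (x y z : I -> R[i]) :
  (forall s, s != 0 -> approx_rank_mod D r T (fun i => x i + s * y i + s ^+ 2 * z i)) ->
  approx_rank_mod D r T z.
Proof.
move=> H; apply: approx_rank_mod_closed => d d0.
pose C := \sum_i (`|x i| + `|y i|).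
have C0 : 0 <= C by apply: sumr_ge0 => i _; rewrite addr_ge0.
(* The error is at most [C / s], and this [s] exceeds [C / d] and is at least 1. *)
pose s := 1 + C / d.
have s1 : 1 <= s by rewrite lerDl divr_ge0 // ltW.
have s_gt0 : 0 < s := lt_le_trans ltr01 s1.
have s0 : s != 0 by rewrite gt_eqF.
exists (fun i => s ^- 2 * (x i + s * y i + s ^+ 2 * z i)).
  by apply: approx_rank_mod_scale; rewrite ?invr_neq0 ?expf_neq0 //; exact: H.
move=> i _; have -> : s ^- 2 * (x i + s * y i + s ^+ 2 * z i) - z i
  = s^-1 * (s^-1 * x i + y i) by field.
rewrite normrM normfV (gtr0_norm s_gt0) mulrC ltr_pdivrMr //.
apply: (@le_lt_trans _ _ C); last first.
  by rewrite /s mulrDr mulr1 mulrC divfK ?gt_eqF // ltrDr.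
apply: (le_trans (ler_normD _ _)).
apply: (@le_trans _ _ (`|x i| + `|y i|)).
  rewrite lerD2r normrM normfV (gtr0_norm s_gt0) ler_piMl // invf_le1 //.
by rewrite /C (bigD1 i) //= lerDl; apply: sumr_ge0 => i' _; rewrite addr_ge0.
Qed.

Section Raising.
Variables (Q : Type) (N M : Q -> I -> I -> R[i]) (T : tensor R[i] I J K).
Variables (r : nat) (lev : I -> nat) (i0 : I).

(** This is exp(s N) when N^3 = 0 and M = N^2 / 2. *)
Definition quad_family q s (i i' : I) : R[i] :=
  (i == i')%:R + s * N q i i' + s ^+ 2 * M q i i'.

Hypothesis symT : forall q s, exists h l, forall i j k, D i ->
  mapA (quad_family q s) (mapB h (mapC l T)) i j k = T i j k.
Hypothesis stabN : forall q i i', D i -> N q i i' != 0 -> D i' && (lev i' < lev i)%N.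
Hypothesis stabM : forall q i i', D i -> M q i i' != 0 -> D i' && (lev i' < lev i)%N.
Hypothesis Di0 : D i0.
Hypothesis kerN : forall a, (forall q i, D i -> app_vec (N q) a i = 0) ->
  forall i, D i -> i != i0 -> a i = 0.

Let B := approx_rank_mod D r T.

Let B_family q s a : B a -> B (app_vec (quad_family q s) a).
Proof.
move=> Ba; have [h [l E]] := symT q s.
apply: (approx_rank_mod_ext (a := app_vec (quad_family q s) a) E) => //.
apply: approx_rank_mod_mapA.
  move=> i i' Di; apply: contraNeq; rewrite /quad_family.
  have [<-//|_] := eqVneq i i'; rewrite add0r.
  have [->|/(stabN Di)/andP[]//] := eqVneq (N q i i') 0.
  have [->|/(stabM Di)/andP[]//] := eqVneq (M q i i') 0.
  by rewrite !mulr0 addr0 eqxx.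
exact/approx_rank_mod_mapB/approx_rank_mod_mapC.
Qed.

Let familyE q s a i :
  app_vec (quad_family q s) a i
  = a i + s * app_vec (N q) a i + s ^+ 2 * app_vec (M q) a i.
Proof.
rewrite /app_vec /quad_family !mulr_sumr.
under eq_bigr => i' _ do rewrite !mulrDl -(mulrA s) -(mulrA (s ^+ 2)).
rewrite !big_split /=; congr (_ + _ + _); rewrite (bigD1 i) //= eqxx mul1r.
by rewrite big1 ?addr0 // => i' /negPf; rewrite eq_sym => ->; rewrite mul0r.
Qed.

Let B_M q a : B a -> B (app_vec (M q) a).
Proof.
move=> Ba; apply: (@approx_rank_mod_lead _ _ a (app_vec (N q) a)) => s _.
by apply: approx_rank_mod_ext (B_family q s Ba) => // i _; rewrite familyE.
Qed.

(** When the quadratic term vanishes, scaling the family by [s] makes [N q] applied to [a] the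
    coefficient of [s ^+ 2]. *)
Let B_N q a : (forall i, D i -> app_vec (M q) a i = 0) -> B a -> B (app_vec (N q) a).
Proof.
move=> M0 Ba; apply: (@approx_rank_mod_lead _ _ (fun=> 0) a) => s s0.
apply: approx_rank_mod_ext (approx_rank_mod_scale s0 (B_family q s Ba)) => // i Di.
by rewrite familyE M0 // mulr0 addr0 mulrDr add0r mulrA -expr2.
Qed.

(** Here [m] bounds from below the levels in the support of [a]. Any nonzero image under some [M q]
    or [N q] is again an admissible direction and has a larger such bound, so the process stops; it
    can only stop in the common kernel of the [N q], the line of [i0]. *)
Lemma raise_to_fixed_line n m a : B a -> (exists2 i, D i & a i != 0) ->
  (forall i, D i -> a i != 0 -> (m <= lev i)%N) ->
  (forall i, D i -> (lev i < m + n)%N) ->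
  exists2 c, c != 0 & B (fun i => c * (i == i0)%:R).
Proof.
elim: n m a => [|n IH] m a Ba [i Di ai] lo hi.
  by have := leq_trans (hi i Di) (eq_leq (addn0 m)); rewrite ltnNge lo.
have up (L : I -> I -> R[i]) :
    (forall i i', D i -> L i i' != 0 -> D i' && (lev i' < lev i)%N) ->
    forall i, D i -> app_vec L a i != 0 -> (m.+1 <= lev i)%N.
  move=> stabL j Dj; apply: contraNT; rewrite -leqNgt => levj.
  rewrite /app_vec big1 // => i' _.
  have [->|/(stabL _ _ Dj)/andP [Di' lt]] := eqVneq (L j i') 0; first by rewrite mul0r.
  have [->|/(lo _ Di')/leq_ltn_trans/(_ lt)] := eqVneq (a i') 0; first by rewrite mulr0.
  by rewrite ltnNge levj.
have hi' j : D j -> (lev j < m.+1 + n)%N by rewrite addSnnS; exact: hi.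
have [[q [j Dj Mj]]|noM] := pselect (exists q, exists2 j, D j & app_vec (M q) a j != 0).
  by apply: (IH m.+1 _ (B_M q Ba)) => //; [exists j | apply: up; exact: stabM].
have M0 q j : D j -> app_vec (M q) a j = 0.
  by move=> Dj; apply/eqP/negP => /negP Mj; apply: noM; exists q; exists j.
have [[q [j Dj Nj]]|noN] := pselect (exists q, exists2 j, D j & app_vec (N q) a j != 0).
  apply: (IH m.+1 _ (B_N (M0 q) Ba)) => //; first by exists j.
  by apply: up; exact: stabN.
have a0 : forall j, D j -> j != i0 -> a j = 0.
  apply: kerN => q j Dj; apply/eqP/negP => /negP Nj.
  by apply: noN; exists q; exists j.
exists (a i0).
  by have [<-//|/(a0 _ Di) ai0] := eqVneq i i0; rewrite ai0 eqxx in ai.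
apply: approx_rank_mod_ext Ba => // j Dj; have [->|/(a0 _ Dj)->] := eqVneq j i0.
  by rewrite mulr1.
by rewrite mulr0.
Qed.

(* The one-parameter groups push an arbitrary quotient direction to the line fixed by all of
   them: the leading coefficient in [s] of a translate is again a quotient direction. *)
Theorem border_substitution : approx_rank D r.+1 T ->
  approx_rank [pred i | D i && (i != i0)] r T.
Proof.
move=> /(approx_rank_substitution Di0) [a a0 Ba].
have [//||c c0 Bc] := @raise_to_fixed_line (\max_i lev i).+1 0 a Ba a0.
  by move=> i _; rewrite add0n ltnS; exact: leq_bigmax.
exact: approx_rank_drop c0 Di0 Bc.
Qed.

End Raising.
End BorderSubstitution.

(** * Koszul flattenings *)

(* A bit sequence is the indicator of a set of basis vectors, hence a basis element of the
   exterior algebra; [kos x u v] is the coefficient of [v] in [x /\ u]. *)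
Fixpoint kos (F : pzRingType) (x : seq F) (u v : bitseq) : F :=
  match x, u, v with
  | x0 :: x', a :: u', b :: v' =>
      if a then if b then - kos x' u' v' else 0
      else if b then if u' == v' then x0 else 0 else kos x' u' v'
  | _, _, _ => 0
  end.

Fixpoint subsets (n k : nat) : seq bitseq :=
  if n is n'.+1 then
    map (cons false) (subsets n' k) ++
      (if k is k'.+1 then map (cons true) (subsets n' k') else [::])
  else if k is 0 then [:: [::]] else [::].

Lemma size_subsets n k : size (subsets n k) = 'C(n, k).
Proof.
elim: n k => [|n IH] [|k] //=; rewrite size_cat !size_map IH ?bin0 // IH.
by rewrite binS.
Qed.

Lemma subsetsF n k u : (false :: u \in subsets n.+1 k) = (u \in subsets n k).
Proof.
have inj b : injective (cons b : bitseq -> bitseq) by move=> ? ? [].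
rewrite mem_cat (mem_map (inj false)); case: k => [|k]; first by rewrite orbF.
by rewrite orbC; case: mapP => // [[? _ []]].
Qed.

Lemma subsetsT n k u : (true :: u \in subsets n.+1 k.+1) = (u \in subsets n k).
Proof.
have inj b : injective (cons b : bitseq -> bitseq) by move=> ? ? [].
by rewrite mem_cat (mem_map (inj true)); case: mapP => // [[? _ []]].
Qed.

Lemma subsetsT0 n u : (true :: u \in subsets n.+1 0) = false.
Proof. by rewrite mem_cat orbF; apply/mapP => [[? _ []]]. Qed.

Lemma subsetsNil n k : ([::] \in subsets n.+1 k) = false.
Proof.
rewrite mem_cat; apply/negbTE; rewrite negb_or; apply/andP; split.
  by apply/mapP => [[]].
by case: k => // k; apply/mapP => [[]].
Qed.

Lemma uniq_subsets n k : uniq (subsets n k).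
Proof.
have inj b : injective (cons b : bitseq -> bitseq) by move=> ? ? [].
elim: n k => [|n IH] [|k] //=; rewrite ?cats0 ?map_inj_uniq //.
rewrite cat_uniq !map_inj_uniq // !IH andbT /=.
by apply/hasPn => _ /mapP [u _ ->]; apply/mapP => [[? _ []]].
Qed.

Section Kos.
Variable F : comNzRingType.

Lemma kos_morph (F' : pzRingType) (f : {rmorphism F -> F'}) x u v :
  kos (map f x) u v = f (kos x u v).
Proof.
elim: x u v => [|x0 x IH] [|a u] [|b v] //=; rewrite ?rmorph0 //.
case: a; case: b; rewrite ?rmorph0 ?IH ?rmorphN //.
by case: eqP; rewrite ?rmorph0.
Qed.

Lemma kos_linear (X L : Type) (f : L -> X -> F) (c : L -> F) (r : seq L) t u v :
  kos [seq \sum_(l <- r) c l * f l s | s <- t] u v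
  = \sum_(l <- r) c l * kos (map (f l) t) u v.
Proof.
have z : 0 = \sum_(l <- r) c l * 0 by rewrite big1 // => l _; rewrite mulr0.
elim: t u v => [|x0 x IH] [|a u] [|b v] //=.
case: a; case: b => //; first 1 last.
  by case: eqP.
by rewrite IH -sumrN; apply: eq_bigr => l _; rewrite mulrN.
Qed.

Lemma sum_delta_seq (X : eqType) (s : seq X) (y : X) (f : X -> F) :
  uniq s -> y \in s -> \sum_(w <- s) (if w == y then f w else 0) = f y.
Proof.
move=> us ys; rewrite (bigD1_seq y) //= eqxx big1 ?addr0 // => w /negPf -> //.
Qed.

(* [x /\ x = 0] *)
Lemma kos_kos n k (x : seq F) u v : size x = n -> u \in subsets n k -> v \in subsets n k.+2 ->
  \sum_(w <- subsets n k.+1) kos x u w * kos x w v = 0.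
Proof.
elim: n k x u v => [|n IH] k [|x0 x] // u v.
move=> [sx]; case: u => [|a u]; first by rewrite subsetsNil.
case: v => [|b v]; first by rewrite subsetsNil.
rewrite [subsets n.+1 k.+1]/= big_cat /= !big_map /=.
case: a; case: b.
- case: k => [|k]; first by rewrite subsetsT0.
  rewrite !subsetsT => uk vk; rewrite big1 ?add0r; last by move=> ? _; rewrite mul0r.
  by under eq_bigr => w _ do rewrite mulrNN; exact: IH.
- move=> _ _; rewrite !big1 ?addr0 // => w _; first by rewrite mulr0.
  by rewrite mul0r.
- rewrite subsetsF subsetsT => uk vk.
  have -> : \sum_(w <- subsets n k.+1) kos x u w * (if w == v then x0 else 0)
      = kos x u v * x0.
    rewrite -(sum_delta_seq (fun w => kos x u w * x0) (uniq_subsets n k.+1) vk).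
    by apply: eq_bigr => w _; case: eqP; rewrite ?mulr0.
  have -> : \sum_(w <- subsets n k) (if u == w then x0 else 0) * - kos x w v
      = - (kos x u v * x0); last by rewrite subrr.
    rewrite -(sum_delta_seq (fun w => - (kos x w v * x0)) (uniq_subsets n k) uk).
    by apply: eq_bigr => w _; rewrite eq_sym; case: eqP; rewrite ?mul0r // mulrN mulrC.
- rewrite !subsetsF => uk vk; rewrite (IH k) // add0r big1 // => w _.
  by rewrite mulr0.
Qed.

End Kos.

(** Rank at most [m] of the submatrix of [M] on rows [A] and columns [B]. With lists of products,
    bounds add by concatenation. *)
Definition factors (F : pzRingType) (X Y : eqType) (A : seq X) (B : seq Y)
    (M : X -> Y -> F) (m : nat) : Prop :=
  exists2 s : seq ((X -> F) * (Y -> F)), (size s <= m)%N &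
    {in A & B, forall x y, M x y = \sum_(pq <- s) pq.1 x * pq.2 y}.

(* Wedging with a nonzero vector of an [n.+1]-dimensional space kills everything divisible by
   it, so its image is that of the exterior power of an [n]-dimensional complement. *)
Lemma kos_factors_pivot (F : fieldType) n k (x0 : F) (x : seq F) :
  x0 != 0 -> size x = n ->
  factors (subsets n.+1 k) (subsets n.+1 k.+1) (kos (x0 :: x)) 'C(n, k).
Proof.
move=> x00 sx.
(* The products of the whole vector X = x0 e_0 + x with the e_w, for w avoiding index 0, span the
   image. Since X /\ X = 0, X /\ e_0 /\ e_u = - x0^-1 X /\ (x /\ e_u), and [P] holds the resulting
   coordinates. *)
pose P w (u : bitseq) : F := if u is a :: u' then
      if a then - (x0^-1 * kos x u' w) else (w == u')%:R else 0.
exists [seq (P w, kos (x0 :: x) (false :: w)) | w <- subsets n k].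
  by rewrite size_map size_subsets.
move=> [|a u] v; rewrite ?subsetsNil // => uk vk; rewrite big_map /=.
case: a uk => [|]; last first.
  rewrite subsetsF => uk.
  rewrite -[LHS](sum_delta_seq (fun w => kos (x0 :: x) (false :: w) v) (uniq_subsets n k) uk).
  by apply: eq_bigr => w _; case: eqP; rewrite ?mul1r ?mul0r.
case: k vk => [|k] vk; first by rewrite subsetsT0.
rewrite subsetsT => uk; case: v vk => [|[] v]; rewrite ?subsetsNil //.
  rewrite subsetsT => vk.
  rewrite -(sum_delta_seq (fun w => - kos x u w) (uniq_subsets n k.+1) vk).
  apply: eq_bigr => w _; case: eqP => _; rewrite ?mulr0 //.
  by rewrite mulNr mulrAC mulVf ?mul1r.
rewrite subsetsF => vk; under eq_bigr => w _ do rewrite mulNr -mulrA.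
by rewrite sumrN -mulr_sumr (kos_kos sx uk vk) mulr0 oppr0.
Qed.

(** A nonzero head serves as pivot. If the head is 0, the matrix is block diagonal according to the
    first bit, and the bounds of the two blocks add up by Pascal's rule. *)
Lemma kos_factors (F : fieldType) n k (x : seq F) : size x = n.+1 ->
  factors (subsets n.+1 k) (subsets n.+1 k.+1) (kos x) 'C(n, k).
Proof.
elim: n k x => [|n IH] k [|x0 x] // [sx];
  (have [->|x00] := eqVneq x0 0; last exact: kos_factors_pivot).
  exists [::] => // u v _ _; rewrite big_nil; case: x sx => // _.
  by case: u v => [|[] u] [|[] v] //=; rewrite ?oppr0 ?if_same.
pose P b (p : bitseq -> F) (u : bitseq) :=
  if u is a :: u' then if a == b then p u' else 0 else 0.
have [s1 ss1 Hs1] := IH k x sx.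
have E1 u v : u \in subsets n.+1 k -> v \in subsets n.+1 k.+1 ->
    kos x u v = \sum_(pq <- s1) P false pq.1 (false :: u) * P false pq.2 (false :: v).
  by move=> uk vk; rewrite Hs1.
case: k => [|k] in s1 ss1 Hs1 E1 *.
  exists [seq (P false pq.1, P false pq.2) | pq <- s1]; first by rewrite size_map bin0 -(bin0 n).
  move=> [|a u] [|b v]; rewrite ?subsetsNil //.
  case: a; rewrite ?subsetsT0 // => uk vk; rewrite big_map /=.
  case: b vk => vk; last by rewrite subsetsF in uk; rewrite subsetsF in vk; exact: E1.
  by rewrite big1 ?if_same // => pq _; rewrite mulr0.
have [s2 ss2 Hs2] := IH k x sx.
exists ([seq (P false pq.1, P false pq.2) | pq <- s1] ++
        [seq (P true pq.1, fun v => - P true pq.2 v) | pq <- s2]).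
  by rewrite size_cat !size_map binS leq_add.
move=> [|a u] [|b v]; rewrite ?subsetsNil // => uk vk.
rewrite big_cat !big_map /=; case: a uk => uk; case: b vk => vk /=.
- rewrite subsetsT in uk; rewrite subsetsT in vk.
  rewrite big1 ?add0r; last by move=> ? _; rewrite mul0r.
  by rewrite Hs2 // -sumrN; apply: eq_bigr => pq _; rewrite mulrN.
- by rewrite !big1 ?addr0 // => pq _; rewrite ?oppr0 ?mulr0 ?mul0r.
- by rewrite !big1 ?addr0 ?if_same // => pq _; rewrite ?oppr0 ?mulr0 ?mul0r.
- rewrite subsetsF in uk; rewrite subsetsF in vk; rewrite Hs1 // [X in _ + X]big1 ?addr0 //.
  by move=> pq _; rewrite mul0r.
Qed.

Definition koszul (F : comNzRingType) n (J K : finType) (X : tensor F 'I_n J K)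
    (uj : bitseq * J) (vk : bitseq * K) : F :=
  kos [seq X s uj.2 vk.2 | s <- enum 'I_n] uj.1 vk.1.

Definition koszul_basis n k (J : finType) : seq (bitseq * J) :=
  [seq (u, j) | u <- subsets n k, j <- enum J].

Lemma mem_koszul_basis n k (J : finType) uj :
  (uj \in koszul_basis n k J) = (uj.1 \in subsets n k).
Proof.
apply/allpairsP/idP => [[[u j] [/= uk _ ->]] //|uk].
by exists uj; split; rewrite ?mem_enum //; case: uj uk.
Qed.

Lemma koszul_factors (F : fieldType) n k (J K : finType) (X : tensor F 'I_n.+1 J K) r :
  rank_le X r ->
  factors (koszul_basis n.+1 k J) (koszul_basis n.+1 k.+1 K) (koszul X) (r * 'C(n, k)).
Proof.
move=> [a [b [c E]]].
pose al l := [seq a l s | s <- enum 'I_n.+1].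
have sal l : size (al l) = n.+1 by rewrite size_map size_enum_ord.
have E1 uj vk : koszul X uj vk
    = \sum_(l <- enum 'I_r) (b l uj.2 * c l vk.2) * kos (al l) uj.1 vk.1.
  rewrite /koszul -kos_linear; congr kos; apply: eq_map => s.
  rewrite E big_enum; apply: eq_bigr => l _ /=.
  by rewrite -mulrA mulrC.
rewrite -{1}(size_enum_ord r); elim: (enum 'I_r) (koszul X) E1 => [|l e IH] M E1.
  by exists [::] => // uj vk _ _; rewrite E1 !big_nil.
pose M' uj vk := \sum_(l <- e) (b l uj.2 * c l vk.2) * kos (al l) uj.1 vk.1.
have [s ss Hs] := IH M' (fun _ _ => erefl); have [t st Ht] := kos_factors k (sal l).
exists ([seq (fun uj : bitseq * J => b l uj.2 * pq.1 uj.1,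
              fun vk : bitseq * K => c l vk.2 * pq.2 vk.1) | pq <- t] ++ s).
  by rewrite size_cat size_map mulSn leq_add.
move=> uj vk ujk vkk; rewrite E1 big_cons big_cat big_map /= -Hs //; congr (_ + _).
move: ujk vkk; rewrite !mem_koszul_basis => ujk vkk; rewrite Ht // mulr_sumr.
by apply: eq_bigr => pq _; rewrite mulrACA.
Qed.

(** If v A' = 0 then v = v E with E = (A - A') A^-1. Once all absolute row sums of E are below 1,
    this strictly decreases the l1 norm of v, a contradiction. *)
Lemma unitmx_open (F : numFieldType) n (A : 'M[F]_n) : A \in unitmx ->
  exists2 d, 0 < d & forall A' : 'M[F]_n, (forall i j, `|A' i j - A i j| < d) -> A' \in unitmx.
Proof.
move=> uA; pose C : F := \sum_i \sum_j `|invmx A i j|.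
have C0 : 0 <= C by apply: sumr_ge0 => i _; apply: sumr_ge0 => j _.
have C1 : 0 < 1 + C by rewrite ltr_pwDl.
exists (1 + C)^-1; first by rewrite invr_gt0.
move=> A' dA; rewrite unitmxE unitfE; apply/det0P => [[v v0 vA]].
pose E := (A - A') *m invmx A.
have vE : v = v *m E by rewrite mulmxA mulmxBr vA subr0 mulmxK.
have rowE i : \sum_j `|E i j| < 1.
  apply: (@le_lt_trans _ _ ((1 + C)^-1 * C)); last first.
    by rewrite mulrC ltr_pdivrMr // mul1r ltrDr.
  rewrite {2}/C exchange_big mulr_sumr; apply: ler_sum => j _.
  rewrite mxE mulr_sumr; apply: (le_trans (ler_norm_sum _ _ _)); apply: ler_sum => k _.
  by rewrite normrM ler_wpM2r // !mxE distrC; exact/ltW/dA.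
have [i vi0] : exists i, v 0 i != 0.
  apply/existsP; rewrite -negb_forall; apply: contra v0 => /forallP h.
  by apply/eqP/rowP => i; rewrite mxE; exact/eqP.
suff : \sum_i `|v 0 i| < \sum_i `|v 0 i| by rewrite ltxx.
rewrite {1}vE; apply: (@le_lt_trans _ _ (\sum_i `|v 0 i| * \sum_j `|E i j|)).
  under [leRHS]eq_bigr => k _ do rewrite mulr_sumr.
  rewrite exchange_big; apply: ler_sum => j _; rewrite mxE.
  by apply: (le_trans (ler_norm_sum _ _ _)); apply: ler_sum => k _; rewrite normrM.
rewrite (bigD1 i) // [ltRHS](bigD1 i) //= ltr_leD //.
  by rewrite gtr_pMr ?normr_gt0.
by apply: ler_sum => k _; rewrite ler_piMr // ltW.
Qed.

Lemma kos_close (F : numFieldType) (d : F) n (x y : 'I_n -> F) s u v : 0 < d ->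
  (forall i, `|x i - y i| < d) -> `|kos (map x s) u v - kos (map y s) u v| < d.
Proof.
move=> d0 xy; have z : `|0 - 0 : F| < d by rewrite subr0 normr0.
elim: s u v => [|i s IH] [|a u] [|b v] //=; case: a; case: b => //.
  by rewrite -opprD normrN.
by case: eqP.
Qed.

(* [rows] holds linear combinations of rows of the flattening. *)
Definition koszul_minor (F : comNzRingType) n (J K : finType) m
    (rows : 'I_m -> seq ((bitseq * J) * F)) (cols : 'I_m -> bitseq * K)
    (X : tensor F 'I_n J K) : 'M[F]_m :=
  \matrix_(i, j) \sum_(rc <- rows i) rc.2 * koszul X rc.1 (cols j).

(** Invertibility of the minor survives passing to a close [S] of honest rank [r], and there the
    minor factors through a space whose dimension is the number of products in [koszul_factors]. *)
Lemma koszul_minor_bound (F : numFieldType) n k (J K : finType) m r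
    (rows : 'I_m -> seq ((bitseq * J) * F)) (cols : 'I_m -> bitseq * K)
    (X : tensor F 'I_n.+1 J K) :
  (forall i rc, rc \in rows i -> rc.1.1 \in subsets n.+1 k) ->
  (forall j, (cols j).1 \in subsets n.+1 k.+1) ->
  koszul_minor rows cols X \in unitmx ->
  approx_rank predT r X -> (m <= r * 'C(n, k))%N.
Proof.
move=> rowsP colsP /unitmx_open [d d0 Hd] HX.
pose C : F := \sum_i \sum_(rc <- rows i) `|rc.2|.
have C0 : 0 <= C by apply: sumr_ge0 => i _; apply: sumr_ge0 => j _.
have C1 : 0 < 1 + C by rewrite ltr_pwDl.
have e0 : 0 < d / (1 + C) by rewrite divr_gt0.
have [S rS HS] := HX _ e0.
have [s ss Hs] := koszul_factors k rS.
have uS : koszul_minor rows cols S \in unitmx.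
  apply: Hd => i j; rewrite !mxE -sumrB; apply: (le_lt_trans (ler_norm_sum _ _ _)).
  apply: (@le_lt_trans _ _ (C * (d / (1 + C)))); last first.
    by rewrite mulrCA gtr_pMr // ltr_pdivrMr // mul1r ltrDr.
  apply: (@le_trans _ _ ((\sum_(rc <- rows i) `|rc.2|) * (d / (1 + C)))).
    rewrite mulr_suml; apply: ler_sum => rc _; rewrite -mulrBr normrM.
    apply: ler_wpM2l => //; apply/ltW/kos_close => // l; exact: HS.
  apply: ler_wpM2r; first exact: ltW.
  rewrite /C (bigD1 i) //= lerDl; apply: sumr_ge0 => ? _; exact: sumr_ge0.
apply: leq_trans ss; rewrite -(mxrank_unit uS).
have -> : koszul_minor rows cols S =
    (\matrix_(i < m, t < size s) \sum_(rc <- rows i) rc.2 * (tnth (in_tuple s) t).1 rc.1)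
    *m (\matrix_(t < size s, j < m) (tnth (in_tuple s) t).2 (cols j)).
  apply/matrixP => i j; rewrite !mxE.
  under [RHS]eq_bigr => t _ do rewrite !mxE mulr_suml.
  rewrite exchange_big /= big_seq [RHS]big_seq; apply: eq_bigr => rc rci.
  rewrite Hs ?mem_koszul_basis ?(rowsP _ _ rci) ?colsP // mulr_sumr.
  by rewrite [LHS]big_tnth; apply: eq_bigr => t _; rewrite mulrA.
exact: leq_trans (mxrankM_maxl _ _) (rank_leq_col _).
Qed.

(** * Integer polynomials as coefficient sequences *)

Fixpoint pev (F : pzRingType) (x : F) (p : seq int) : F :=
  if p is c :: p' then c%:~R + x * pev x p' else 0.

Fixpoint padd (p q : seq int) : seq int :=
  match p, q with
  | [::], _ => q
  | _, [::] => p
  | c :: p', d :: q' => (c + d) :: padd p' q'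
  end.

Fixpoint pmul (p q : seq int) : seq int :=
  if p is c :: p' then padd (map (fun d => c * d) q) (0 :: pmul p' q) else [::].

(* The second factor is delayed, so that it is not evaluated when the first one vanishes. *)
Definition pmul_lazy (p : seq int) (q : unit -> seq int) : seq int :=
  if p is [::] then [::] else pmul p (q tt).

Definition psum (n : nat) (f : nat -> seq int) : seq int :=
  foldr (fun m => padd (f m)) [::] (iota 0 n).

Section Pev.
Variables (F : comNzRingType) (x : F).

Lemma pev_add p q : pev x (padd p q) = pev x p + pev x q.
Proof.
elim: p q => [|c p IH] [|d q] /=; rewrite ?add0r ?addr0 //.
by rewrite IH rmorphD /= mulrDr addrACA.
Qed.

Lemma pev_scale c p : pev x (map (fun d => c * d) p) = c%:~R * pev x p.
Proof.
elim: p => [|d p IH] /=; first by rewrite mulr0.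
by rewrite IH rmorphM /= mulrDr mulrCA.
Qed.

Lemma pev_mul p q : pev x (pmul p q) = pev x p * pev x q.
Proof.
elim: p => [|c p IH] /=; first by rewrite mul0r.
by rewrite pev_add pev_scale /= add0r IH mulrDl mulrA.
Qed.

Lemma pev_mul_lazy p q : pev x (pmul_lazy p q) = pev x p * pev x (q tt).
Proof. by case: p => [|c p]; rewrite ?pev_mul //= mul0r. Qed.

Lemma pev_sum n f : pev x (psum n f) = \sum_(m < n) pev x (f m).
Proof.
rewrite -(big_mkord xpredT (fun m => pev x (f m))) /index_iota subn0 /psum.
by elim: (iota 0 n) => [|m s IH] /=; rewrite ?big_nil // big_cons pev_add IH.
Qed.

Lemma pev_const c p : all (eq_op^~ 0) (behead p) -> head 0 p = c -> pev x p = c%:~R.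
Proof.
case: p => [|d p] /= p0 <- //; suff -> : pev x p = 0 by rewrite mulr0 addr0.
by elim: p p0 => [//|e p IH] /= /andP [/eqP -> /IH ->]; rewrite mulr0 addr0.
Qed.

End Pev.

(** Horner reduction modulo x^2 + 1. *)
Definition gauss (p : seq int) : int * int :=
  foldr (fun c z => (c - z.2, z.1)) (0, 0) p.

Lemma pev_gauss (F : comNzRingType) (x : F) p : x ^+ 2 = -1 ->
  pev x p = (gauss p).1%:~R + x * (gauss p).2%:~R.
Proof.
move=> x2; elim: p => [|c p IH] /=; first by rewrite mulr0 addr0.
rewrite IH mulrDr mulrA -expr2 x2 mulN1r rmorphB /=.
by rewrite addrA addrAC.
Qed.

Lemma all_iotaP n (P : pred nat) : reflect (forall i : 'I_n, P i) (all P (iota 0 n)).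
Proof.
apply: (iffP allP) => [H i|H i]; first by apply: H; rewrite mem_iota /=.
by rewrite mem_iota /= => lt_in; exact: (H (Ordinal lt_in)).
Qed.

(** * The structure tensor in a weight basis *)

(* [(f_0, f_4)] and [(f_1, f_3)] are isotropic pairs, written as polynomials in [i];
   the weight vectors of [so_5] are the [f_a /\ f_b]. *)
Definition isotropic_basis (a p : nat) : seq int :=
  nth [::] (nth [::]
    [:: [:: [:: 1]; [:: 0; 1]; [::]; [::]; [::]];
        [:: [::]; [::]; [:: 1]; [:: 0; 1]; [::]];
        [:: [::]; [::]; [::]; [::]; [:: 1]];
        [:: [::]; [::]; [:: 1]; [:: 0; -1]; [::]];
        [:: [:: 1]; [:: 0; -1]; [::]; [::]; [::]]] a) p.

Definition weight_pairs : seq (nat * nat) :=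
  [:: (0, 1); (0, 2); (0, 3); (0, 4); (1, 2); (1, 3); (1, 4); (2, 3); (2, 4); (3, 4)]%N.

Definition weight_vector (i p q : nat) : seq int :=
  let: (a, b) := nth (0, 0)%N weight_pairs i in
  padd (pmul (isotropic_basis a p) (isotropic_basis b q))
    (map -%R (pmul (isotropic_basis b p) (isotropic_basis a q))).

Definition weight_bracket (i j p q : nat) : seq int :=
  psum 5 (fun m => padd
    (pmul_lazy (weight_vector i p m) (fun=> weight_vector j m q))
    (map -%R (pmul_lazy (weight_vector j p m) (fun=> weight_vector i m q)))).

(** The third factor is also read off against the [f_a /\ f_b], through a multiple of the trace
    form. By invariance the tensor becomes an alternating 3-form, nonzero only on triples of weights
    with sum 0; one representative per unordered triple is listed. *)
Definition weight_triples : seq (nat * nat * nat * int) :=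
  [:: (0, 3, 9, 2%Z); (0, 5, 9, 2%Z); (0, 7, 8, 1%Z); (1, 3, 8, 1%Z); (1, 4, 9, 1%Z);
      (1, 6, 7, 1%Z); (2, 3, 6, 2%Z); (2, 4, 8, - 1%Z); (2, 5, 6, - 2%Z); (4, 5, 7, 1%Z)]%N.

Definition weight_tensor (i j k : nat) : int :=
  foldr (fun e acc =>
    let: (a, b, c, v) := e in
    if (i, j, k) \in [:: (a, b, c); (b, c, a); (c, a, b)] then v
    else if (i, j, k) \in [:: (b, a, c); (a, c, b); (c, b, a)] then - v
    else acc) 0 weight_triples.

Definition weight_tensor_check :=
  all (fun i => all (fun j => all (fun k =>
    gauss (psum 5 (fun p => psum 5 (fun q =>
      if (p < q)%N then pmul_lazy (weight_vector k p q) (fun=> weight_bracket i j p q)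
      else [::]))) == (4 * weight_tensor i j k, 0))
    (iota 0 10)) (iota 0 10)) (iota 0 10).

Lemma weight_tensor_checkE : weight_tensor_check.
Proof. by vm_cast_no_check (erefl true). Qed.

Lemma sum_so5_idx (V : nmodType) (f : 'I_5 -> 'I_5 -> V) :
  \sum_(s : so5_idx) f (val s).1 (val s).2 = \sum_(p < 5) \sum_(q < 5 | (p < q)%N) f p q.
Proof.
rewrite pair_big_dep /=.
by rewrite [RHS](big_sub [pred pq : 'I_5 * 'I_5 | (pq.1 < pq.2)%N]
  (fun pq => f pq.1 pq.2)).
Qed.

Section StructureTensor.
Variable R : realType.
Let C := R[i].

Lemma so5_basis_expand (M : 'I_5 -> 'I_5 -> C) :
  (forall p q, M q p = - M p q) -> (forall p, M p p = 0) ->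
  \sum_(s : so5_idx) M (val s).1 (val s).2 *: so5_basis R s = \matrix_(p, q) M p q.
Proof.
move=> skew diag; apply/matrixP => p q; rewrite summxE mxE.
under eq_bigr => s _ do rewrite /so5_basis !mxE.
rewrite (sum_so5_idx (fun a b => M a b *
  (((p == a) && (q == b))%:R - ((p == b) && (q == a))%:R))).
rewrite pair_big_dep /=.
pose f (ab : 'I_5 * 'I_5) := M ab.1 ab.2 *
  (((p == ab.1) && (q == ab.2))%:R - ((p == ab.2) && (q == ab.1))%:R).
have z ab : ab != (p, q) -> ab != (q, p) -> f ab = 0.
  case: ab => a b; rewrite /f !xpair_eqE /= => n1 n2.
  by rewrite (eq_sym p) (eq_sym q) (negPf n1) (eq_sym p b) (eq_sym q a) andbC (negPf n2)
     subrr mulr0.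
case: (ltngtP p q) => [pq|qp|/val_inj pq].
- rewrite (bigD1 (p, q)) //= big1 ?addr0.
    rewrite !eqxx /= (_ : (p == q) = false) ?subr0 ?mulr1 //.
    by apply: contraTF pq => /eqP ->; rewrite ltnn.
  move=> ab /andP [lt_ab ne]; apply: z => //.
  by apply: contraTneq lt_ab => -> /=; rewrite -leqNgt ltnW.
- rewrite (bigD1 (q, p)) //= big1 ?addr0.
    rewrite !eqxx /= (_ : (p == q) = false) ?sub0r ?mulrN1 ?(skew q p) //.
    by apply: contraTF qp => /eqP ->; rewrite ltnn.
  move=> ab /andP [lt_ab ne]; apply: z => //.
  by apply: contraTneq lt_ab => -> /=; rewrite -leqNgt ltnW.
- subst q; rewrite diag big1 // => ab lt_ab.
  by apply: z; apply: contraTneq lt_ab => -> /=; rewrite ltnn.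
Qed.

Let I_C : C := 'i%C.
Let P (i : 'I_10) (s : so5_idx) : C := pev I_C (weight_vector i (val s).1 (val s).2).

Lemma pev_opp (F : comNzRingType) (x : F) p : pev x (map -%R p) = - pev x p.
Proof.
by elim: p => [|d p IH] /=; rewrite ?oppr0 // IH rmorphN /= mulrN opprD.
Qed.

Let W (i : 'I_10) : 'M[C]_5 := \matrix_(p, q) pev I_C (weight_vector i p q).

Let W_expand i : \sum_s P i s *: so5_basis R s = W i.
Proof.
apply: (so5_basis_expand (M := fun p q : 'I_5 => pev I_C (weight_vector i p q))).
  move=> p q; rewrite /weight_vector; case: (nth _ _ _) => a b.
  by rewrite !pev_add !pev_opp !pev_mul opprD opprK addrC; congr (_ + _); rewrite mulrC.
move=> p; rewrite /weight_vector; case: (nth _ _ _) => a b.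
by rewrite !pev_add !pev_opp !pev_mul mulrC subrr.
Qed.

Lemma lie_bracket_sum (X Y : finType) n (a : X -> C) (b : Y -> C)
    (A : X -> 'M[C]_n) (B : Y -> 'M[C]_n) :
  lie_bracket (\sum_x a x *: A x) (\sum_y b y *: B y)
  = \sum_x \sum_y (a x * b y) *: lie_bracket (A x) (B y).
Proof.
rewrite /lie_bracket mulmx_suml mulmx_sumr -sumrB; apply: eq_bigr => x _.
rewrite mulmx_sumr mulmx_suml -sumrB; apply: eq_bigr => y _.
by rewrite -!scalemxAl -!scalemxAr !scalerA scalerBr (mulrC (b y)).
Qed.

(** The nonzero values are, up to sign, products of three pairings, where [f_0] with [f_4] and [f_1]
    with [f_3] give 2 and [f_2] with itself gives 1; at least two of the three are 2, whence the
    common factor 4. *)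
Lemma weight_tensorE (i j k : 'I_10) :
  mapA P (mapB P (mapC P (T_so5 R))) i j k = 4 * (weight_tensor i j k)%:~R.
Proof.
have -> : mapA P (mapB P (mapC P (T_so5 R))) i j k
    = \sum_u P k u * so5_coord (lie_bracket (W i) (W j)) u.
  rewrite -!W_expand lie_bracket_sum /so5_coord.
  under [RHS]eq_bigr => u _ do rewrite summxE mulr_sumr.
  rewrite exchange_big; apply: eq_bigr => s _; rewrite mulr_sumr.
  under [RHS]eq_bigr => u _ do rewrite summxE mulr_sumr.
  rewrite exchange_big; apply: eq_bigr => t _; rewrite !mulr_sumr.
  apply: eq_bigr => u _; rewrite mxE /T_so5 /so5_coord !mulrA.
  by congr (_ * _); rewrite mulrC mulrA.
have BE (p q : 'I_5) : lie_bracket (W i) (W j) p q = pev I_C (weight_bracket i j p q).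
  rewrite pev_sum !mxE -sumrB; apply: eq_bigr => m _.
  by rewrite !mxE pev_add pev_opp !pev_mul_lazy.
rewrite /P /so5_coord (sum_so5_idx (fun p q => pev I_C (weight_vector k p q) *
  lie_bracket (W i) (W j) p q)).
have := weight_tensor_checkE.
move=> /all_iotaP/(_ i)/all_iotaP/(_ j)/all_iotaP/(_ k)/eqP; set p := psum _ _ => pE.
transitivity (pev I_C p).
  rewrite pev_sum; apply: eq_bigr => a _; rewrite pev_sum big_mkcond; apply: eq_bigr => b _.
  by case: ifP => _ //; rewrite pev_mul_lazy BE.
by rewrite (pev_gauss _ (sqr_i _)) pE /= mulr0 addr0 rmorphM.
Qed.

Lemma approx_rank_weight_tensor r : border_rank_le (T_so5 R) r ->
  approx_rank predT r (fun i j k : 'I_10 => (weight_tensor i j k)%:~R : C).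
Proof.
move=> /border_rank_le_approx H d d0.
have [d1 d10 H1] := app_vec_close P d0.
have [d2 d20 H2] := app_vec_close P d10.
have [d3 d30 H3] := app_vec_close (fun i s => P i s / 4) d20.
have [S rS HS] := H _ d30.
exists (mapA P (mapB P (mapC (fun i s => P i s / 4) S))).
  exact/rank_le_mapA/rank_le_mapB/rank_le_mapC.
move=> i j k _.
have -> : (weight_tensor i j k)%:~R
    = mapA P (mapB P (mapC (fun i s => P i s / 4) (T_so5 R))) i j k.
  have f4 : 4 != 0 :> C by rewrite pnatr_eq0.
  apply: (mulfI f4); rewrite -weight_tensorE /mapA /mapB /mapC /app_vec.
  rewrite !mulr_sumr; apply: eq_bigr => s _; rewrite mulrCA; congr (_ * _).
  rewrite !mulr_sumr; apply: eq_bigr => t _; rewrite mulrCA; congr (_ * _).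
  by rewrite !mulr_sumr; apply: eq_bigr => u _; rewrite mulrA mulrCA divff // mulr1.
by apply: H1 => s _; apply: H2 => t _; apply: H3 => u _; exact: HS.
Qed.

End StructureTensor.

(** * Symmetries *)

(* The matrices of [ad e] and [(ad e)^2 / 2] for the two simple root vectors [e], proportional to
   [f_0 /\ f_3] and [f_1 /\ f_2]; their third powers vanish. *)
Definition raise1 (q : bool) (i i' : nat) : int :=
  let l := if q then
      [:: (1, 0, 1%Z); (2, 1, - 2%Z); (5, 4, - 2%Z); (7, 5, 1%Z); (8, 6, 1%Z); (9, 8, - 2%Z)]%N
    else
      [:: (3, 2, - 1%Z); (4, 1, 1%Z); (5, 2, 1%Z); (6, 3, 1%Z); (6, 5, - 1%Z); (8, 7, - 1%Z)]%N
  in foldr (fun e acc => if (i, i') == e.1 then e.2 else acc) 0 l.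

Definition raise2 (q : bool) (i i' : nat) : int :=
  let l := if q then [:: (2, 0); (7, 4); (9, 6)]%N else [:: (6, 2)]%N in
  if (i, i') \in l then -1 else 0.

(** A zero entry is normalised to [[::]], the form on which [pmul_lazy] stops. *)
Definition raise_poly (q : bool) (i i' : nat) : seq int :=
  let p := [:: (i == i')%:R; raise1 q i i'; raise2 q i i'] in
  if all (eq_op^~ 0) p then [::] else p.

Definition raise_check :=
  all (fun q => all (fun i => all (fun j => all (fun k =>
    let p := psum 10 (fun i' => pmul_lazy (raise_poly q i i') (fun=>
      psum 10 (fun j' => pmul_lazy (raise_poly q j j') (fun=>
        psum 10 (fun k' => pmul_lazy (raise_poly q k k') (fun=>
          [:: weight_tensor i' j' k'])))))) in
    all (eq_op^~ 0) (behead p) && (head 0 p == weight_tensor i j k))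
    (iota 0 10)) (iota 0 10)) (iota 0 10)) [:: false; true].

Lemma raise_checkE : raise_check.
Proof. by vm_cast_no_check (erefl true). Qed.

Lemma raise1_lt q i i' : raise1 q i i' != 0 -> (i' < i)%N.
Proof.
rewrite /raise1; set l := (if q then _ else _).
have : all (fun e => e.1.2 < e.1.1)%N l by rewrite {}/l; case: q.
elim: l => //= e l IH /andP [lt_e /IH lt_l].
by case: ((i, i') =P e.1) => [E _|_ /lt_l //]; rewrite -E in lt_e.
Qed.

Lemma raise2_lt q i i' : raise2 q i i' != 0 -> (i' < i)%N.
Proof.
rewrite /raise2; case: ifP => //; case: q; rewrite !inE.
  by move=> /or3P [] /eqP [-> ->].
by move=> /eqP [-> ->].
Qed.

(* For each [i < 9], rows of the raising operators whose sum only involves coordinate [i]. *)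
Definition kernel_rows : seq (seq (bool * nat)) :=
  [:: [:: (true, 1)]; [:: (false, 4)]; [:: (false, 5)]; [:: (false, 6); (true, 7)];
      [:: (true, 5)]; [:: (true, 7)]; [:: (true, 8)]; [:: (false, 8)]; [:: (true, 9)]]%N.

Definition kernel_check :=
  all (fun i => all (fun i' =>
      let c := foldr (fun qj acc => raise1 qj.1 qj.2 i' + acc) 0 (nth [::] kernel_rows i) in
      (c == 0) == (i' != i)) (iota 0 10) &&
    all (fun qj => (qj.2 < (if i == 8 then 10 else 9))%N) (nth [::] kernel_rows i)) (iota 0 9).

Lemma kernel_checkE : kernel_check.
Proof. by vm_cast_no_check (erefl true). Qed.

Section WeightTensor.
Variable R : realType.
Let C := R[i].

Definition weight_tensorC (i j k : 'I_10) : C := (weight_tensor i j k)%:~R.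
Let N q (i i' : 'I_10) : C := (raise1 q i i')%:~R.
Let M q (i i' : 'I_10) : C := (raise2 q i i')%:~R.

Lemma raise_polyE q s (i i' : 'I_10) :
  pev s (raise_poly q i i') = quad_family N M q s i i'.
Proof.
have E : pev s [:: (i == i' :> nat)%:R; raise1 q i i'; raise2 q i i'] = quad_family N M q s i i'.
  rewrite /quad_family /N /M /= mulr0 addr0 mulrDr mulrA -expr2 addrA.
  by rewrite (_ : (i == i' :> nat) = (i == i')) //; case: (i == i').
rewrite -E /raise_poly; case: ifP => // /and4P [/eqP -> /eqP -> /eqP -> _].
by rewrite /= !mulr0z !(mulr0, addr0).
Qed.

Lemma raise_sym q s (i j k : 'I_10) :
  mapA (quad_family N M q s) (mapB (quad_family N M q s)
    (mapC (quad_family N M q s) weight_tensorC)) i j k = weight_tensorC i j k.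
Proof.
have := raise_checkE; move=> /allP /(_ q) h.
have {}h := h (ltac:(by case: (q)) : q \in [:: false; true]).
move: h.
move=> /all_iotaP/(_ i)/all_iotaP/(_ j)/all_iotaP/(_ k)/andP [].
set p := psum _ _ => p1 /eqP p2; rewrite [RHS]/weight_tensorC -(pev_const s p1 p2) /p.
rewrite pev_sum; apply: eq_bigr => i' _; rewrite pev_mul_lazy raise_polyE; congr (_ * _).
rewrite pev_sum; apply: eq_bigr => j' _; rewrite pev_mul_lazy raise_polyE; congr (_ * _).
rewrite pev_sum; apply: eq_bigr => k' _; rewrite pev_mul_lazy raise_polyE; congr (_ * _).
by rewrite /= mulr0 addr0.
Qed.

(** Covers both substitutions: on the quotient with top index 8, the rows isolating the coordinates
    below 8 stay within index 8; only coordinate 8 itself calls for row 9. *)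
Lemma raise_kernel (i0 : 'I_10) (a : 'I_10 -> C) : (8 <= i0)%N ->
  (forall q (i : 'I_10), (i <= i0)%N -> app_vec (N q) a i = 0) ->
  forall i : 'I_10, (i <= i0)%N -> i != i0 -> a i = 0.
Proof.
move=> i08 Na i lei nei.
have lti : (i < i0)%N by rewrite ltn_neqAle lei andbT.
have i9 : (i < 9)%N by rewrite (leq_trans lti) // -ltnS.
have := kernel_checkE => /all_iotaP/(_ (Ordinal i9)) /andP [/all_iotaP /= h /allP l9].
pose c i' : int := \sum_(qj <- nth [::] kernel_rows i) raise1 qj.1 qj.2 i'.
have cE (i' : 'I_10) : (c i' == 0) = (i' != i).
  have /eqP <- := h i'; congr (_ == _); rewrite /c.
  by elim: (nth _ _ _) => [|x s IH]; rewrite ?big_nil // big_cons IH.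
have : \sum_(i' < 10) (c i')%:~R * a i' = 0.
  under eq_bigr => i' _ do rewrite /c rmorph_sum /= mulr_suml.
  rewrite exchange_big big_seq big1 // => qj /l9 qjl.
  have j10 : (qj.2 < 10)%N by apply: leq_trans qjl _; case: ifP.
  rewrite -[RHS](Na qj.1 (Ordinal j10)) //=.
  case: eqP qjl lti i08 => [i8|_] qjl lti i08; first by rewrite i8 in lti; apply: leq_trans lti.
  by apply: leq_trans i08.
rewrite (bigD1 i) //= big1 ?addr0.
  by move=> /eqP; rewrite mulf_eq0 intr_eq0 cE eqxx /= => /eqP.
by move=> i' ne; move: ne; rewrite -cE => /eqP ->; rewrite mul0r.
Qed.

Lemma weight_tensor_drop r (i0 : 'I_10) : (8 <= i0)%N ->
  approx_rank [pred i : 'I_10 | (i <= i0)%N] r.+1 weight_tensorC ->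
  approx_rank [pred i : 'I_10 | (i < i0)%N] r weight_tensorC.
Proof.
move=> i08 H.
have K : approx_rank [pred i : 'I_10 | (i <= i0)%N && (i != i0)] r weight_tensorC.
  apply: (@border_substitution _ _ _ _ [pred i : 'I_10 | (i <= i0)%N] _ N M _ _ val) => //=.
  - by move=> q s; exists (quad_family N M q s), (quad_family N M q s) => i j k _;
      exact: raise_sym.
  - move=> q i i' lei; rewrite intr_eq0 => /raise1_lt lt.
    by rewrite lt (leq_trans (ltnW lt)).
  - move=> q i i' lei; rewrite intr_eq0 => /raise2_lt lt.
    by rewrite lt (leq_trans (ltnW lt)).
  - by move=> a; exact: raise_kernel.
move=> d /K [S rS HS]; exists S => // i j k /= lt; apply: HS => /=.
by rewrite (ltnW lt) -(inj_eq val_inj) neq_ltn /= lt.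
Qed.

End WeightTensor.

(** * The Koszul flattening of the quotient *)

(* A seven-dimensional quotient of the eight remaining coordinates; the last form mixes the
   highest root vector with a Cartan element, which a coordinate subspace would not achieve. *)
Definition quotient_forms : seq (seq nat) :=
  [:: [:: 1]; [:: 2]; [:: 3]; [:: 4]; [:: 6]; [:: 7]; [:: 0; 5]]%N.

Definition quotient_slice (j k : nat) : seq int :=
  [seq foldr (fun i acc => weight_tensor i j k + acc) 0 l | l <- quotient_forms].

Definition quotient_table : seq (seq (seq int)) :=
  Eval vm_compute in mkseq (fun j => mkseq (quotient_slice j) 10) 10.

Definition quotient_entry (uj vk : bitseq * nat) : int :=
  kos (nth [::] (nth [::] quotient_table uj.2) vk.2) uj.1 vk.1.

(* Gaussian elimination modulo 3; each row carries its expression in terms of the initial rows. *)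
Fixpoint eliminate (C : Type) (cols : seq C) (rows : seq (seq nat * seq nat)) :
    seq (C * seq nat) :=
  if cols is c :: cols' then
    let drop_head (r : seq nat * seq nat) := (behead r.1, r.2) in
    let zs := [seq drop_head r | r <- rows & head 0%N r.1 == 0%N] in
    if [seq r <- rows | head 0%N r.1 != 0%N] is p :: ps then
      let sub m (x y : seq nat) := [seq ((xy.1 + m * xy.2) %% 3)%N | xy <- zip x y] in
      let reduce (r : seq nat * seq nat) :=
        let m := (2 * head 0%N r.1 * head 0%N p.1)%N in
        drop_head (sub m r.1 p.1, sub m r.2 p.2) in
      (c, p.2) :: eliminate cols' (zs ++ map reduce ps)
    else eliminate cols' zs
  else [::].

Definition row_labels : seq (bitseq * nat) := [seq (u, j) | u <- subsets 7 3, j <- iota 0 10].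
Definition col_labels : seq (bitseq * nat) := [seq (v, k) | v <- subsets 7 4, k <- iota 0 10].

(** Each pivot row vanishes modulo 3 in the columns of the earlier pivots; reversing the order makes
    the minor lower triangular. In [eliminate], the factor 2 is -1 and a nonzero residue modulo 3 is
    its own inverse. *)
Definition pivots : seq ((bitseq * nat) * seq ((bitseq * nat) * nat)) :=
  Eval vm_compute in
    rev [seq (cl.1, [seq rc <- zip row_labels cl.2 | rc.2 != 0%N]) |
       cl <- eliminate col_labels
         [seq ([seq `|(quotient_entry (nth ([::], 0%N) row_labels i) c %% 3)%Z|%N | c <- col_labels],
               [seq nat_of_bool (i == i') | i' <- iota 0 350]) | i <- iota 0 350]].

Lemma size_pivots : size pivots = 322.
Proof. by vm_compute. Qed.

Definition pivot_minor (row col : (bitseq * nat) * seq ((bitseq * nat) * nat)) : int :=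
  foldr (fun rc acc => rc.2%:R * quotient_entry rc.1 col.1 + acc) 0 row.2.

Definition pivots_check :=
  [&& pairwise (fun row col => 3 %| pivot_minor row col)%Z pivots,
      all (fun e => ~~ (3 %| pivot_minor e e)%Z) pivots &
      all (fun e => [&& e.1.1 \in subsets 7 4, (e.1.2 < 10)%N &
        all (fun rc => (rc.1.1 \in subsets 7 3) && (rc.1.2 < 10)%N) e.2]) pivots].

Lemma pivots_checkE : pivots_check.
Proof. by vm_cast_no_check (erefl true). Qed.

Lemma quotient_tableE j k : (j < 10)%N -> (k < 10)%N ->
  nth [::] (nth [::] quotient_table j) k = quotient_slice j k.
Proof.
have -> : quotient_table = mkseq (fun j => mkseq (quotient_slice j) 10) 10.
  by vm_cast_no_check (erefl quotient_table).
by move=> j10 k10; rewrite nth_mkseq // nth_mkseq.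
Qed.

Lemma sum_ord_mem (F : pzRingType) n (l : seq nat) (f : nat -> F) :
  uniq l -> all (ltn^~ n) l -> \sum_(i < n) (val i \in l)%:R * f i = \sum_(m <- l) f m.
Proof.
move=> ul /allP ln; rewrite -(big_mkord xpredT (fun i => (i \in l)%:R * f i)).
under eq_bigr => i _ do rewrite mulr_natl mulrb.
rewrite -big_mkcond -big_filter; apply: perm_big; apply: uniq_perm => //.
  by rewrite filter_uniq // iota_uniq.
by move=> m; rewrite mem_filter mem_index_iota /= andb_idr // => /ln.
Qed.

Section Flattening.
Variable R : realType.
Let C := R[i].
Let dflt : (bitseq * nat) * seq ((bitseq * nat) * nat) := (([::], 0%N), [::]).
Let V (s : 'I_7) (i : 'I_10) : C := (val i \in nth [::] quotient_forms s)%:R.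
Let X := mapA V (@weight_tensorC R).
Let rows (a : 'I_(size pivots)) : seq ((bitseq * 'I_10) * C) :=
  [seq ((rc.1.1, inord rc.1.2), rc.2%:R) | rc <- (nth dflt pivots a).2].
Let cols (b : 'I_(size pivots)) : bitseq * 'I_10 :=
  let c := (nth dflt pivots b).1 in (c.1, inord c.2).

Let pivotP (a : 'I_(size pivots)) : let e := nth dflt pivots a in
  [/\ e.1.1 \in subsets 7 4, (e.1.2 < 10)%N &
      forall rc, rc \in e.2 -> (rc.1.1 \in subsets 7 3) && (rc.1.2 < 10)%N].
Proof.
have /and3P [_ _ /allP h] := pivots_checkE.
by have /and3P [? ? /allP ?] := h _ (mem_nth dflt (ltn_ord a)).
Qed.

Let X_slice (j k : 'I_10) :
  [seq X s j k | s <- enum 'I_7] = map intr (quotient_slice j k).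
Proof.
have sz : size (quotient_slice j k) = 7%N by rewrite size_map.
have -> : map intr (quotient_slice j k)
    = [seq (nth 0 (quotient_slice j k) (val s))%:~R | s <- enum 'I_7] :> seq C.
  rewrite (map_comp (fun m => (nth 0 (quotient_slice j k) m)%:~R)) val_enum_ord map_comp.
  by rewrite map_nth_iota0 ?sz // take_oversize ?sz.
apply: eq_map => s; rewrite /X /mapA /app_vec /weight_tensorC /=.
rewrite (nth_map [::]) ?ltn_ord //.
have : all (fun l => uniq l && all (ltn^~ 10) l) quotient_forms by [].
move=> /allP/(_ _ (mem_nth [::] (ltn_ord s : (s < size quotient_forms)%N))) /andP [ul ln].
rewrite (sum_ord_mem (fun i => (weight_tensor i j k)%:~R) ul ln).
elim: (nth _ _ _) => [|m l IH]; first by rewrite big_nil.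
by rewrite big_cons IH rmorphD.
Qed.

Let minorE : koszul_minor rows cols X
  = map_mx intr (\matrix_(a, b) pivot_minor (nth dflt pivots a) (nth dflt pivots b)).
Proof.
apply/matrixP => a b; rewrite !mxE big_map.
have [_ _] := pivotP a; have [_ c10 _] := pivotP b.
rewrite /pivot_minor; elim: (nth dflt pivots a).2 => [|rc l IH] rP.
  by rewrite big_nil.
rewrite big_cons IH; last by move=> rc' h; apply: rP; rewrite inE h orbT.
have /andP [_ r10] := rP _ (mem_head _ _).
rewrite rmorphD rmorphM /= rmorph_nat; congr (_ * _ + _).
by rewrite /koszul X_slice kos_morph !inordK // /quotient_entry quotient_tableE.
Qed.

Let minor_unit : koszul_minor rows cols X \in unitmx.
Proof.
(* The minor has integer entries, so it is enough that its determinant is nonzero in ['F_3]. *)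
rewrite minorE unitmxE unitfE det_map_mx intr_eq0; set Z := matrix_of_fun _ _.
have ch3 : 3%N \in [pchar 'F_3] by rewrite pchar_Fp.
have dv (z : int) : (z%:~R == 0 :> 'F_3) = (3 %| z)%Z by rewrite -(dvdz_pcharf ch3).
suff : \det (map_mx intr Z : 'M['F_3]_(size pivots)) != 0.
  by apply: contraNneq; rewrite det_map_mx => ->.
have /and3P [/(pairwiseP dflt) tr /allP dg _] := pivots_checkE.
rewrite det_trig; last first.
  by apply/is_trig_mxP => a b ab; apply/eqP; rewrite !mxE dv tr // inE.
apply/prodf_neq0 => a _; rewrite !mxE dv; apply: dg; exact: mem_nth.
Qed.

Lemma weight_tensor_quotient_bound r :
  approx_rank [pred i : 'I_10 | (i < 8)%N] r (@weight_tensorC R) -> (17 <= r)%N.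
Proof.
move=> H; have HX : approx_rank predT r X.
  move=> d d0; have [d' d'0 Hd] := app_vec_close V d0.
  have [S rS HS] := H _ d'0; exists (mapA V S); first exact: rank_le_mapA.
  move=> s j k _; apply: Hd => i; rewrite /V pnatr_eq0 eqb0 negbK => il; apply: HS => /=.
  (* The seven forms only involve slices that survive both substitutions. *)
  have : all (all (ltn^~ 8)) quotient_forms by [].
  by move=> /allP/(_ _ (mem_nth [::] (ltn_ord s : (s < size quotient_forms)%N))) /allP; apply.
have rowsP a rc : rc \in rows a -> rc.1.1 \in subsets 7 3.
  have [_ _ h] := pivotP a.
  by move=> /mapP [rc' rc'P ->]; have /andP [] := h _ rc'P.
have colsP b : (cols b).1 \in subsets 7 4 by have [] := pivotP b.
have := koszul_minor_bound rowsP colsP minor_unit HX.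
rewrite size_pivots (_ : 'C(6, 3) = 20%N) // => bnd.
rewrite ltnNge; apply: contraTN bnd => r16.
by rewrite -ltnNge ltnS (leq_trans (leq_mul r16 (leqnn _))).
Qed.

End Flattening.

Theorem theorem5 (R : realType) (r : nat) :
  border_rank_le (T_so5 R) r -> (19 <= r)%N.
Proof.
move=> /approx_rank_weight_tensor H; rewrite leqNgt; apply/negP => r19.
have H18 : approx_rank [pred i : 'I_10 | (i <= 9)%N] 18 (@weight_tensorC R).
  move=> d /(approx_rank_mono (r19 : (r <= 18)%N) H) [S rS HS].
  by exists S => // i j k _; exact: HS.
have H17 := @weight_tensor_drop R 17 (Ordinal (isT : (9 < 10)%N)) isT H18.
have H16 := @weight_tensor_drop R 16 (Ordinal (isT : (8 < 10)%N)) isT H17.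
by have := weight_tensor_quotient_bound H16.
Qed.
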